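(* Let $r \ge 2$ be an even and $a \ge 3$ an odd positive integer. Let $d$, $s$ and $x$ be positive integers such that $\frac{d+s}{r+a} = x = \frac{d}{r}$, $x \ge 2$ and $d > \frac{a}{r}$. Then there exists a simple $(d,d+s)$-graph which has no $(r,r+a)$-factorization with $x$ factors.
   Context: All graphs are finite simple graphs. A $(d,d+s)$-graph is a graph all of whose vertex degrees lie in $\{d, \ldots, d+s\}$. An $(r,r+a)$-factor of $G$ is a spanning subgraph all of whose degrees lie in $\{r,\ldots,r+a\}$; an $(r,r+a)$-factorization of $G$ with $x$ factors is a decomposition of $E(G)$ into $x$ edge-disjoint $(r,r+a)$-factors. *)

(* Defs.v *)
From mathcomp Require Import all_boot all_order all_algebra.

Set Implicit Arguments.
Unset Strict Implicit.
Unset Printing Implicit Defensive.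

Record sgraph := SGraph {
  vertex :> finType;
  edges : {set {set vertex}};
  edges_card2 : forall e, e \in edges -> #|e| = 2
}.

Definition degree (V : finType) (E : {set {set V}}) (v : V) : nat :=
  #|[set e in E | v \in e]|.

Definition degrees_in (m n : nat) (V : finType) (E : {set {set V}}) : Prop :=
  forall v : V, m <= degree E v <= n.

Definition is_graph (m n : nat) (G : sgraph) : Prop :=
  degrees_in m n (edges G).

(* A spanning subgraph of G keeps all vertices, so it is given by its edges;
   the degree condition ranges over every vertex of G. *)
Definition is_factor (m n : nat) (G : sgraph) (F : {set {set G}}) : Prop :=
  F \subset edges G /\ degrees_in m n F.

Definition is_factorization (m n x : nat) (G : sgraph)
    (F : 'I_x -> {set {set G}}) : Prop :=
  [/\ forall i, is_factor m n (F i),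
      forall i j, i != j -> [disjoint F i & F j]
    & \bigcup_(i < x) F i = edges G].

Definition has_factorization (m n x : nat) (G : sgraph) : Prop :=
  exists F : 'I_x -> {set {set G}}, is_factorization m n F.

(* Main.v *)
Require Import Defs.
From mathcomp Require Import all_boot all_order all_algebra.
From mathcomp Require Import zify.

Set Implicit Arguments.
Unset Strict Implicit.
Unset Printing Implicit Defensive.

(** Here d = rx and d + s = (r+a)x, so a vertex v of degree d + s has the odd
    degree r + a in every factor.  By the handshake lemma the degrees of the
    other n vertices in a factor then have an odd sum, which exceeds the even
    lower bound rn; summing over the factors, these vertices have total degree at
    least x(rn + 1) = dn + x in G.  It remains to build G with a vertex v of
    degree d + s in which all other vertices have degree d, except for at most
    one of degree d + 1: take disjoint copies of K_(d+1), join v to two vertices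
    in each of (d+s)/2 copies (and to one vertex of a further copy if d + s is
    odd), and delete the edges between neighbours of v. *)

Lemma degreeE (V : finType) (E : {set {set V}}) (v : V) :
  degree E v = \sum_(e in E) (v \in e).
Proof.
rewrite /degree -sum1_card -big_mkcondr /=.
by apply: eq_bigl => e; rewrite inE.
Qed.

Lemma handshake (V : finType) (E : {set {set V}}) :
  (forall e, e \in E -> #|e| = 2) -> \sum_v degree E v = 2 * #|E|.
Proof.
move=> E2; under eq_bigr do rewrite degreeE.
rewrite exchange_big /= mulnC -sum_nat_const; apply: eq_bigr => e eE.
by rewrite -big_mkcond sum1_card E2.
Qed.

Lemma degree_factorization (G : sgraph) (m n x : nat)
    (F : 'I_x -> {set {set G}}) (v : G) :
  is_factorization m n F -> degree (edges G) v = \sum_(i < x) degree (F i) v.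
Proof.
case=> _ disjF <-; rewrite degreeE partition_disjoint_bigcup //=.
by apply: eq_bigr => i _; rewrite degreeE.
Qed.

Lemma sum_upper_bound_eq (I : finType) (f : I -> nat) (M : nat) :
  (forall i, f i <= M) -> \sum_i f i = #|I| * M -> forall i, f i = M.
Proof.
move=> fM sumf i.
have := leqif_sum (fun j (_ : true) => leqif_eq (fM j)).
by rewrite sum_nat_const sumf => -[_]; rewrite eqxx => /esym/forallP/(_ i)/eqP.
Qed.

Lemma no_factorization (G : sgraph) (r a x : nat) (v w : G) :
    ~~ odd r -> odd a -> 2 <= x ->
    degree (edges G) v = (r + a) * x ->
    (forall u, u != v -> degree (edges G) u <= r * x + (u == w)) ->
  ~ has_factorization r (r + a) x G.
Proof.
move=> r_even a_odd x2 degv degu [F Ffact].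
have [Ffac _ _] := Ffact.
(* The [x] degrees of [v] in the factors are at most [r + a] and sum to [(r + a) * x], so each
   attains the bound. *)
have Fv i : degree (F i) v = r + a.
  move: i; apply: sum_upper_bound_eq => [i|].
    by have [_ /(_ v)/andP[]] := Ffac i.
  by rewrite -(degree_factorization v Ffact) degv card_ord mulnC.
pose n := #|[pred u | u != v]|.
have lbF i : r * n + 1 <= \sum_(u | u != v) degree (F i) u.
  have [FG Fdeg] := Ffac i.
  have lb : r * n <= \sum_(u | u != v) degree (F i) u.
    by rewrite mulnC -sum_nat_const; apply: leq_sum => u _; case/andP: (Fdeg u).
  have := handshake (E := F i) (fun e eF => edges_card2 (subsetP FG e eF)).
  rewrite (bigD1 v) //= Fv => hs.
  (* With equality the degree sum [r + a + r * n] would be odd, against the handshake lemma. *)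
  rewrite addn1 ltn_neqAle lb andbT; apply/eqP => eqn; move/(congr1 odd): hs.
  by rewrite -eqn mul2n odd_double !oddD oddM (negbTE r_even) a_odd.
have lbG : x * (r * n + 1) <= \sum_(u | u != v) degree (edges G) u.
  under [X in _ <= X]eq_bigr do rewrite (degree_factorization _ Ffact).
  rewrite exchange_big /= -{1}(card_ord x) -sum_nat_const.
  exact: leq_sum.
have ubG : \sum_(u | u != v) degree (edges G) u <= n * (r * x) + 1.
  apply: (@leq_trans (\sum_(u | u != v) (r * x + (u == w)))); first exact: leq_sum.
  rewrite big_split /= sum_nat_const leq_add2l.
  rewrite big_mkcond (bigD1 w) //= big1 => [|u /negbTE->]; last by case: ifP.
  by rewrite addn0 eqxx; case: ifP.
(* The two bounds on the degree sum give [x <= 1]. *)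
nia.
Qed.

Section RelGraph.

Variables (T : finType) (adj : rel T).
Hypotheses (adj_sym : symmetric adj) (adj_irr : irreflexive adj).

Definition rel_edges : {set {set T}} :=
  [set [set p.1; p.2] | p in [pred p : T * T | adj p.1 p.2]].

Lemma rel_edges_card2 e : e \in rel_edges -> #|e| = 2.
Proof.
case/imsetP => -[u w] /= /[!inE] uw ->; rewrite cards2.
by case: eqP uw => // ->; rewrite adj_irr.
Qed.

Definition rel_graph : sgraph := SGraph rel_edges_card2.

Lemma degree_rel_graph v : degree (edges rel_graph) v = #|[set u | adj v u]|.
Proof.
rewrite /degree /=.
have -> : [set e in rel_edges | v \in e]
          = [set [set v; u] | u in [set u | adj v u]].
  apply/setP => e; rewrite inE; apply/andP/imsetP => [[/imsetP[[u w] /=]]|].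
    rewrite !inE => uw -> /set2P[->|->]; first by exists w; rewrite ?inE.
    by exists u; rewrite ?inE 1?adj_sym // setUC.
  case=> u /[!inE] vu ->; split; last by rewrite set21.
  by apply/imsetP; exists (v, u); rewrite ?inE.
(* A neighbour [u] differs from [v] by irreflexivity, so the edge [[set v; u]] determines it. *)
apply: card_in_imset => u w /[!inE] vu vw /setP/(_ u).
by rewrite !inE eqxx orbT; case: eqP vu => [->|_ _ /esym/eqP] //; rewrite adj_irr.
Qed.

End RelGraph.

Section Construction.

Variables (d D : nat).
Hypothesis d_gt0 : 0 < d.

Definition copies : finType := option ('I_D * 'I_d.+1).

(* Vertex [j] of the [i]-th clique is joined to the centre [None]; this selects
   [D] clique vertices, at most two per clique. *)
Definition joined (i : 'I_D) (j : 'I_d.+1) : bool := (j < 2) && (i.*2 + j < D).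

Definition star_adj (u w : copies) : bool :=
  match u, w with
  | None, None => false
  | None, Some p => joined p.1 p.2
  | Some p, None => joined p.1 p.2
  | Some p, Some q => [&& p.1 == q.1, p.2 != q.2
                        & ~~ (joined p.1 p.2 && joined q.1 q.2)]
  end.

Lemma star_adj_sym : symmetric star_adj.
Proof.
move=> [p|] [q|] //=.
by rewrite eq_sym (eq_sym p.2) (andbC (joined p.1 p.2)).
Qed.

Lemma star_adj_irr : irreflexive star_adj.
Proof. by move=> [p|] //=; rewrite !eqxx. Qed.

Definition star_graph : sgraph := rel_graph star_adj_irr.

Lemma card_joined i : #|[set j | joined i j]| = (i.*2 < D) + (i.*2.+1 < D).
Proof.
rewrite -sum1_card big_mkcond /= /joined.
under eq_bigr do rewrite inE.
(* As [d > 0], the clique has vertices 0 and 1; all later terms vanish. *)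
case: d d_gt0 => // e _; rewrite !big_ord_recl big1 => [|j _] /=; last by [].
by rewrite /bump /= addn0 addn1; do 2!case: (_ < D).
Qed.

Lemma degree_center : degree (edges star_graph) None = D.
Proof.
rewrite degree_rel_graph; last exact: star_adj_sym.
have -> : [set u | star_adj None u]
          = [set Some p | p in [set p : 'I_D * 'I_d.+1 | joined p.1 p.2]].
  apply/setP => -[p|]; rewrite inE /=.
    by rewrite mem_imset ?inE // => ? ? [].
  by apply/esym/imsetP => -[].
rewrite card_imset; last by move=> ? ? [].
rewrite -sum1_card (eq_bigl (fun p : 'I_D * 'I_d.+1 => true && joined p.1 p.2)).
  rewrite -(pair_big_dep xpredT joined (fun _ _ => 1)) /=.
  (* Each clique contributes 2 until [D] is nearly used up, then at most one contributes 1, and the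
     rest 0. *)
  have sumE n : \sum_(i < n) ((i.*2 < D) + (i.*2.+1 < D)) = minn n.*2 D.
    elim: n => [|n IHn]; first by rewrite big_ord0 min0n.
    by rewrite big_ord_recr /= IHn; lia.
  transitivity (minn D.*2 D); last by lia.
  rewrite -sumE; apply: eq_bigr => i _; rewrite -card_joined -sum1_card.
  by apply: eq_bigl => j; rewrite inE.
by move=> p; rewrite inE.
Qed.

(** A joined vertex trades the edge to the other joined vertex of its clique for the edge to the
    centre. It gains one only if it has no such partner, which happens when [D] is odd, in the last
    clique reached. *)
Lemma degree_clique_vertex i j :
  degree (edges star_graph) (Some (i, j))
  = d + (joined i j && (i.*2.+1 == D)).
Proof.
rewrite degree_rel_graph; last exact: star_adj_sym.
pose N := [set j' | (j != j') && ~~ (joined i j && joined i j')].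
have -> : [set u | star_adj (Some (i, j)) u]
          = [set u | (u == None) && joined i j] :|: [set Some (i, j') | j' in N].
  apply/setP => -[[i' j']|]; rewrite !inE /=; last first.
    by case: imsetP => [[]|]; rewrite ?orbF.
  apply/and3P/imsetP => [[/eqP <- jj' nJ]|[j'' + [-> ->]]].
    by exists j'; rewrite // inE jj'.
  by rewrite inE eqxx => /andP[].
rewrite cardsU.
have -> : [set u | (u == None) && joined i j] :&: [set Some (i, j') | j' in N]
          = set0.
  by apply/setP => -[p|]; rewrite !inE //; apply/andP => -[_ /imsetP[]].
rewrite cards0 subn0 card_imset; last by move=> ? ? [].
have [Jij|nJ] := boolP (joined i j); last first.
  have -> : N = [set~ j] by apply/setP => j'; rewrite !inE (negbTE nJ) andbT eq_sym.
  rewrite cardsC1 card_ord (_ : [set u | _] = set0) ?cards0 ?addn0 //.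
  by apply/setP => u; rewrite !inE andbF.
(* A joined [j] loses every joined vertex of its clique, itself included. *)
have -> : N = ~: [set j' | joined i j'].
  apply/setP => j'; rewrite !inE Jij /=.
  by case: eqP => // <-; rewrite Jij.
rewrite (_ : [set u | _] = [set None]); last first.
  by apply/setP => u; rewrite !inE andbT.
rewrite cards1 cardsCs setCK card_ord card_joined.
by case/andP: Jij; lia.
Qed.

End Construction.

Theorem theorem30 (r a d s x : nat)
  (hr : 2 <= r) (hr_even : ~~ odd r)
  (ha : 3 <= a) (ha_odd : odd a)
  (hd : 0 < d) (hs : 0 < s) (hx0 : 0 < x)
  (hdsx : ((d + s)%N%:R / (r + a)%N%:R = x%:R :> rat)%R)
  (hdx : (x%:R = d%:R / r%:R :> rat)%R)
  (hx : 2 <= x)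
  (hda : (a%:R / r%:R < d%:R :> rat)%R) :
  exists G : sgraph,
    is_graph d (d + s) G /\ ~ has_factorization r (r + a) x G.
Proof.
have quotE m n k : 0 < n -> (m%:R / n%:R = k%:R :> rat)%R -> m = n * k.
  move=> n0 /(canRL (GRing.divfK _)) mE; apply/eqP.
  by rewrite -(Num.Theory.eqr_nat rat) mulnC GRing.natrM mE // Num.Theory.pnatr_eq0 -lt0n.
have dE : d = r * x by apply: quotE; [lia | exact/esym].
have dsE : d + s = (r + a) * x by apply: quotE; [lia | exact: hdsx].
exists (star_graph d (d + s)); split.
  case=> [[i j]|]; last by rewrite degree_center //; lia.
  by rewrite degree_clique_vertex // leq_addr leq_add2l (leq_trans (leq_b1 _) hs).
(* For odd [d + s] this index is the clique with a single joined vertex, vertex 0; for even [d + s]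
   no vertex has degree [d + 1], and any [w] serves. *)
have i0P : (d + s)./2 < d + s by lia.
pose w : star_graph d (d + s) := Some (Ordinal i0P, ord0).
apply: (no_factorization (v := None : star_graph d (d + s)) (w := w)) => //.
  by rewrite degree_center.
case=> [[i j]|] // _; rewrite degree_clique_vertex // -dE leq_add2l.
case: (boolP (_ && _)) => //= /andP[/andP[_ ij] /eqP iE].
(* Since [d + s] is [i.*2.+1], the bound [i.*2 + j < d + s] forces [j = 0]. *)
suff -> : Some (i, j) == w by [].
by apply/eqP; congr (Some (_, _)); apply: val_inj => /=; lia.
Qed.
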